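(* Let $(G,\cdot)$ and $(H,\circ)$ be any two distinct loops. (1) If a triple $\alpha=(A,B,B)$ is an isotopism of $(G,\cdot)$ upon $(H,\circ)$, then $(G,\cdot)$ is an LC-loop if and only if $(H,\circ)$ is an LC-loop. (2) If a triple $\alpha=(A,B,A)$ is an isotopism of $(G,\cdot)$ upon $(H,\circ)$, then $(G,\cdot)$ is an RC-loop if and only if $(H,\circ)$ is an RC-loop.
   Context: A loop is a quasigroup with a two-sided identity element. Maps are written on the right of their arguments. A triple $(U,V,W)$ of bijections $U,V,W:G\to H$ is an isotopism of the loop $(G,\cdot)$ upon the loop $(H,\circ)$ if $xU\circ yV=(x\cdot y)W$ for all $x,y\in G$. A loop is an LC-loop if $(xx)(yz)=(x(xy))z$ for all $x,y,z$, and an RC-loop if $(zy)(xx)=z((yx)x)$ for all $x,y,z$. *)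

(* Defs.v *)
From HB Require Import structures.
From mathcomp Require Import all_boot.

Set Implicit Arguments.
Unset Strict Implicit.
Unset Printing Implicit Defensive.

Local Open Scope group_scope.

HB.mixin Record isQuasigroup G & Magma G := {
  ldiv_unique : forall a b : G, exists! x : G, a * x = b;
  rdiv_unique : forall a b : G, exists! y : G, y * a = b
}.

#[short(type="quasigroupType")]
HB.structure Definition Quasigroup := {G of isQuasigroup G & Magma G}.

(* The library's BaseUMagma_isUMagma cannot be reused for the identity: HB ties
   it to umagmaType, which requires a choiceType carrier. *)
HB.mixin Record Quasigroup_isLoop G & Quasigroup G := {
  loop_id : exists e : G, left_id e (@mul G) /\ right_id e (@mul G)
}.

#[short(type="loopType")]
HB.structure Definition Loop := {G of Quasigroup_isLoop G & Quasigroup G}.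

Definition LC_loop (G : loopType) : Prop :=
  forall x y z : G, (x * x) * (y * z) = (x * (x * y)) * z.

Definition RC_loop (G : loopType) : Prop :=
  forall x y z : G, (z * y) * (x * x) = z * ((y * x) * x).

(* Maps written on the right of their arguments become ordinary application:
   xU is [U x]. *)
Record isotopism (G H : loopType) (U V W : G -> H) : Prop := Isotopism {
  isotopism_bijl : bijective U;
  isotopism_bijr : bijective V;
  isotopism_bijp : bijective W;
  isotopismM : forall x y : G, U x * V y = W (x * y)
}.

(* Main.v *)
(** A loop is an LC-loop exactly when [x(x(yz)) = (x(xy))z], i.e. when
    [L_x L_x L_y] is again a left translation, necessarily by its value [x(xy)]
    at the identity. An isotopism [(A, B, B)] satisfies
    [L_(xA) = B^-1 L_x B], hence conjugates left translations to left
    translations and preserves this property. The RC case is the LC case of the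
    opposite loops. *)
Require Import Defs.
From mathcomp Require Import all_boot.

(* Bare operations rather than loops, so that the lemmas apply to the opposite
   multiplication as well. *)
Definition LC_law {T : Type} (m : T -> T -> T) : Prop :=
  forall x y z, m (m x x) (m y z) = m (m x (m x y)) z.

(** Both laws give [m (m x x) t = m x (m x t)]: put [e] for [z] in the first, for [y] in the
    second. *)
Lemma LC_lawP {T : Type} {m : T -> T -> T} {e : T} :
    left_id e m -> right_id e m ->
  LC_law m <-> forall x y z, m x (m x (m y z)) = m (m x (m x y)) z.
Proof.
move=> m1x mx1; split=> mLC x y z.
  have sqE t : m (m x x) t = m x (m x t) by have:= mLC x t e; rewrite !mx1.
  by rewrite -sqE mLC.
have sqE t : m x (m x t) = m (m x x) t by have:= mLC x e t; rewrite m1x mx1.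
by rewrite -mLC sqE.
Qed.

Lemma LC_law_isotopic {S T : Type} {m : S -> S -> S} {n : T -> T -> T}
    {e : S} {f : T} {A B : S -> T} :
    left_id e m -> right_id e m -> left_id f n -> right_id f n ->
    bijective A -> bijective B -> (forall x y, n (A x) (B y) = B (m x y)) ->
  LC_law m -> LC_law n.
Proof.
move=> m1x mx1 n1x nx1 [A' _ A'K] [B' _ B'K] nAB /(LC_lawP m1x mx1) mLC.
apply/(LC_lawP n1x nx1) => x y z; rewrite -(A'K x) -(A'K y).
set a := A' x; set b := A' y.
have transE t : n (A a) (n (A a) (n (A b) t)) = n (A (m a (m a b))) t.
  by rewrite -(B'K t) !nAB mLC.
(* At [t = f], [transE] identifies [A (m a (m a b))] with [n (A a) (n (A a) (A b))]. *)
by rewrite transE; have:= transE f; rewrite !nx1 => ->.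
Qed.

Lemma LC_law_isotopicE {S T : Type} {m : S -> S -> S} {n : T -> T -> T}
    {e : S} {f : T} {A B : S -> T} :
    left_id e m -> right_id e m -> left_id f n -> right_id f n ->
    bijective A -> bijective B -> (forall x y, n (A x) (B y) = B (m x y)) ->
  LC_law m <-> LC_law n.
Proof.
move=> m1x mx1 n1x nx1 bijA bijB nAB; split.
  exact: (LC_law_isotopic m1x mx1 n1x nx1 bijA bijB nAB).
(* The inverse triple [(A', B', B')] has the same shape, from [n] back to [m]. *)
have [[A' AK A'K] [B' BK B'K]] := (bijA, bijB).
have bijA' : bijective A' by exists A.
have bijB' : bijective B' by exists B.
apply: (LC_law_isotopic n1x nx1 m1x mx1 bijA' bijB') => x y.
by apply: (bij_inj bijB); rewrite -nAB A'K !B'K.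
Qed.

Theorem theorem3p7 (G H : loopType) (neqGH : G <> H) :
  (forall A B : G -> H, isotopism A B B -> (LC_loop G <-> LC_loop H)) /\
  (forall A B : G -> H, isotopism A B A -> (RC_loop G <-> RC_loop H)).
Proof.
have [[e [m1x mx1]] [f [n1x nx1]]] := (@loop_id G, @loop_id H).
split=> A B [bijA bijB _ AB].
  exact: (LC_law_isotopicE m1x mx1 n1x nx1 bijA bijB AB).
(* Reversing both products turns [(A, B, A)] into [(B, A, A)]; [RC_loop] is convertible to [LC_law]
   of the reversed product. *)
exact: (LC_law_isotopicE (m := fun x y => mul y x) (n := fun x y => mul y x)
          mx1 m1x nx1 n1x bijB bijA (fun x y => AB y x)).
Qed.
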